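(* Let $a,b,c,d,e,g,h,r$ be real numbers. If the series converge, then \[ -\int_0^1\!\!\int_0^1\frac{x^{b-1}y^{g-1}}{(1-rx^cy^h)\log(x^ay^d)}\,dx\,dy=\sum_{n=0}^\infty r^n\,\frac{\log\left(\frac{d}{a}\right)-\log\left(\frac{hn+g}{cn+b}\right)}{-a(hn+g)+bd+cdn}, \] and \[ \int_0^1\!\!\int_0^1\frac{x^{b-1}y^{e-1}\left(x^ay^d-1\right)}{\left(1-rx^cy^h\right)\log(x^ay^d)}\,dx\,dy=\sum_{n=0}^\infty r^n\,\frac{\log\left(\frac{(b+cn)(d+e+hn)}{(a+b+cn)(e+hn)}\right)}{bd-ae+cdn-ahn}. \]
   Formalization: Proved with added conditions the identities need: b>0, c,h≥0 and all series denominators nonzero; for the first also g>0 and d/a>0; for the second also e>0, a+b>0, d+e>0. Without them the integrals can diverge or terms be undefined. *)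

(* Defs.v *)
From HB Require Import structures.
From mathcomp Require Import all_boot all_order all_algebra.
From mathcomp Require Import all_classical all_reals all_analysis.
Set Implicit Arguments. Unset Strict Implicit. Unset Printing Implicit Defensive.
Import Order.TTheory GRing.Theory Num.Theory.
Local Open Scope ring_scope.

Definition integrand1 {R : realType} (a b c d g h r : R) (x y : R) : R :=
  (x `^ (b - 1) * y `^ (g - 1)) /
  ((1 - r * (x `^ c * y `^ h)) * ln (x `^ a * y `^ d)).

Definition term1 {R : realType} (a b c d g h r : R) (n : nat) : R :=
  r ^+ n * ((ln (d / a) - ln ((h * n%:R + g) / (c * n%:R + b))) /
            (- a * (h * n%:R + g) + b * d + c * d * n%:R)).

Definition integrand2 {R : realType} (a b c d e h r : R) (x y : R) : R :=
  (x `^ (b - 1) * y `^ (e - 1) * (x `^ a * y `^ d - 1)) /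
  ((1 - r * (x `^ c * y `^ h)) * ln (x `^ a * y `^ d)).

Definition term2 {R : realType} (a b c d e h r : R) (n : nat) : R :=
  r ^+ n * (ln (((b + c * n%:R) * (d + e + h * n%:R)) /
                ((a + b + c * n%:R) * (e + h * n%:R))) /
            (b * d - a * e + c * d * n%:R - a * h * n%:R)).

(* Main.v *)
Require Import Defs.
From HB Require Import structures.
From mathcomp Require Import all_boot all_order all_algebra.
From mathcomp Require Import all_classical all_reals all_analysis.
From mathcomp Require Import measurable_realfun ring lra.
Import Order.TTheory GRing.Theory Num.Theory numFieldNormedType.Exports.
Local Open Scope ring_scope.
Local Open Scope classical_set_scope.

(** Write [phi z] for the integral of [z `^ t] over [t] in [J]: it is [- 1 / ln z]
    for [J = [0, +oo[] and [0 < z < 1], and [(z - 1) / ln z] for [J = [0, 1]].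
    With [w = x `^ c * y `^ h], both integrands are
    [x `^ (b - 1) * y `^ (g - 1) * phi (x `^ a * y `^ d) / (1 - r * w)]
    up to sign, and by Tonelli the [n]-th term of the geometric expansion
    integrates over the unit square to the integral [t n] over [J] of
    [1 / ((b + c n + a s) (g + h n + d s))], a difference quotient of [ln].

    Convergence forces [|r| <= 1] since [t n] is at least of order [1 / n^2].
    For [r > 0] the expansion is integrated term by term by monotone convergence;
    for [r <= 0] the remainder after [N] terms is at most [|r ^+ N * t N|], which
    tends to [0], so that no absolute convergence is needed (at [r = -1] there is
    none). *)

(** * One-dimensional integrals *)

(** Inversion is continuous on the open complement of [0], and on a singleton every function is
    measurable. *)
Lemma measurable_inv (R : realType) : measurable_fun [set: R] (@GRing.inv R).
Proof.
rewrite -(setUv [set (0 : R)]); apply/measurable_funU => //.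
  exact: measurableC.
split; first exact: measurable_fun_set1.
apply: open_continuous_measurable_fun; first exact: closed_openC.
by move=> x; rewrite inE /= => /eqP; exact: inv_continuous.
Qed.

Lemma powR_expR (R : realType) (x p : R) : 0 < x -> x `^ p = expR (p * ln x).
Proof. by move=> x0; rewrite /powR gt_eqF. Qed.

(** For [p < 1] the integrand is unbounded near [0], so []0, 1]] is exhausted by the intervals
    [[1 / (n + 1), 1]]. The fundamental theorem applies on each, and in the monotone limit the
    contribution of the lower endpoint vanishes because [0 < p]. *)
Lemma integral_powR01 (R : realType) (p : R) : 0 < p ->
  (\int[lebesgue_measure]_(x in `]0%R, 1%R[) (x `^ (p - 1))%:E = (p^-1)%:E)%E.
Proof.
move=> p0.
have mf D : measurable_fun D (fun x : R => (x `^ (p - 1))%:E).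
  by apply/measurable_EFinP/measurable_funTS; exact: measurable_powR.
pose F (n : nat) : set R := `[n.+1%:R^-1, 1]%classic.
have FU : \bigcup_n F n = `]0%R, 1%R]%classic.
  apply/seteqP; split => x /=; rewrite in_itv/=.
    move=> [n _]; rewrite /F /= in_itv/= => /andP[nx ->]; rewrite andbT.
    by rewrite (lt_le_trans _ nx)// invr_gt0.
  move=> /andP[x0 x1]; have [n nx] := ltr_add_invr x0.
  by exists n => //; rewrite /F /= in_itv/= x1 andbT ltW// -[n.+1%:R^-1]add0r.
rewrite integral_itv_bndo_bndc// -FU.
have Fcvg : (\int[lebesgue_measure]_(x in F i) (x `^ (p - 1))%:E)%E @[i --> \oo]
    --> (\int[lebesgue_measure]_(x in \bigcup_i F i) (x `^ (p - 1))%:E)%E.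
  apply: ge0_nondecreasing_set_cvg_integral => //.
  - move=> n m nm; apply/subsetPset => x; rewrite /F /= !in_itv/= => /andP[nx ->].
    by rewrite andbT (le_trans _ nx)// lef_pV2 ?posrE// ler_nat.
  - by move=> n; exact: measurable_itv.
  - by move=> n; exact: mf.
  - by move=> n x _; rewrite lee_fin powR_ge0.
have FE (n : nat) : (\int[lebesgue_measure]_(x in F n) (x `^ (p - 1))%:E)%E =
    (p^-1 - p^-1 * (n.+1%:R^-1) `^ p)%:E.
  (* [F 0] is the single point [1], whereas the fundamental theorem is applied to proper
     intervals. *)
  case: n => [|n].
    rewrite /F invr1 powR1 mulr1 subrr set_itv1.
    by rewrite integral_set1.
  have n1 : n.+2%:R^-1 < 1 :> R by rewrite invf_lt1// ltr1n.
  have n0 : 0 < n.+2%:R^-1 :> R by rewrite invr_gt0.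
  have dpow (x : R) : n.+2%:R^-1 <= x ->
    is_derive x 1 (fun x : R => p^-1 * x `^ p) (x `^ (p - 1)).
    move=> nx; have x0 : 0 < x by apply: lt_le_trans nx.
    have := is_derive1_powR p x0 => D.
    rewrite -[x `^ (p - 1)](mulKf (lt0r_neq0 p0)).
    exact: (is_deriveZ p^-1).
  rewrite (@continuous_FTC2 _ _ (fun x : R => p^-1 * x `^ p)) //.
  - by rewrite powR1 mulr1 -EFinB.
  - apply: derivable_within_continuous => x; rewrite in_itv/= => /andP[nx _].
    by apply: derivable_powR; rewrite in_itv/= (lt_le_trans n0 nx).
  - have cc : {within `[n.+2%:R^-1, 1], continuous (fun x : R => p^-1 * x `^ p)}.
      apply: derivable_within_continuous => x; rewrite in_itv/= => /andP[nx _].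
      by have [] := dpow x nx.
    split.
    + move=> x; rewrite in_itv/= => /andP[/ltW nx _].
      by have [] := dpow x nx.
    + by move/continuous_within_itvP: cc => /(_ n1)[].
    + by move/continuous_within_itvP: cc => /(_ n1)[].
  - move=> x; rewrite in_itv/= => /andP[/ltW nx _].
    by rewrite derive1E; have [_ ->] := dpow x nx.
rewrite -(cvg_lim _ Fcvg)//; apply/cvg_lim => //.
under eq_cvg do rewrite FE.
apply: cvg_EFin; first exact: nearW.
rewrite -[X in _ --> X]subr0; apply: cvgB; first exact: cvg_cst.
rewrite -[X in _ --> X](mulr0 p^-1); apply: cvgMr.
apply: cvg_comp (powR_cvg0 p0).
(* The limit of the power at [0] is taken from the right, so positivity of [1 / (n + 1)] is needed
   besides its convergence to [0]. *)
move=> U U0; have := @cvg_harmonic R _ U0; rewrite !nbhs_filterE /=.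
by apply: (@filterS _ \oo) => n; apply; rewrite /harmonic /= invr_gt0.
Qed.

Lemma is_derive_affine (R : realType) (p q t : R) :
  is_derive t 1 (fun s : R => p + q * s) q.
Proof.
have D : is_derive t (1 : R) (fun s : R => q * s) (q *: 1).
  exact: (is_deriveZ q (is_derive_id t 1)).
rewrite -[X in is_derive _ _ _ X]add0r -[X in _ + X]mulr1.
exact: (is_deriveD (is_derive_cst p t 1) D).
Qed.

Section exponential_integrals.
Variables (R : realType) (l : R).
Hypothesis l0 : l != 0.

Let dexp (t : R) : is_derive t 1 (fun t => l^-1 * expR (l * t)) (expR (l * t)).
Proof.
have D : is_derive t (1 : R) (fun s : R => l * s) (l *: 1).
  exact: (is_deriveZ l (is_derive_id t 1)).
have E := is_derive1_comp (is_derive_expR (l * t)) D.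
apply: (is_derive_eq (is_deriveZ l^-1 E)).
by rewrite /GRing.scale /= mulr1 mulrC mulfK.
Qed.

Let cexp : continuous (fun t => expR (l * t)).
Proof.
move=> t; apply: continuous_comp; last exact: continuous_expR.
by apply: cvgMr; exact: cvg_id.
Qed.

Let cprim : continuous (fun t => l^-1 * expR (l * t)).
Proof. by move=> t; apply: cvgMr; exact: cexp. Qed.

Lemma integral_expR01 :
  (\int[lebesgue_measure]_(t in `[0%R, 1%R]) (expR (l * t))%:E =
   ((expR l - 1) / l)%:E)%E.
Proof.
rewrite (@continuous_FTC2 _ _ (fun t => l^-1 * expR (l * t))) //.
- by rewrite !mulr0 mulr1 expR0 mulr1 -EFinB mulrBl mul1r mulrC.
- exact: continuous_subspaceT.
- split.
  + by move=> t _; have [] := dexp t.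
  + by apply: cvg_at_right_filter; exact: cprim.
  + by apply: cvg_at_left_filter; exact: cprim.
- by move=> t _; rewrite derive1E; have [_ ->] := dexp t.
Qed.

Lemma integral_expR0y : l < 0 ->
  (\int[lebesgue_measure]_(t in `[0%R, +oo[) (expR (l * t))%:E =
   (- l^-1)%:E)%E.
Proof.
move=> l_lt0.
rewrite (@ge0_continuous_FTC2y _ _ (fun t => l^-1 * expR (l * t)) _ 0) //.
- by rewrite mulr0 expR0 mulr1 sub0e.
- exact: continuous_subspaceT.
- rewrite -[X in _ --> X](mulr0 l^-1); apply: cvgMr.
  have -> : (fun t => expR (l * t)) = (fun s => expR (- s)) \o (fun t => - l * t).
    by apply/funext => t /=; rewrite mulNr opprK.
  apply: cvg_comp (@cvgr_expR R).
  by apply: gt0_cvgMry; [rewrite oppr_gt0|exact: cvg_id].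
- by apply: cvg_at_right_filter; exact: cprim.
- by move=> t _; rewrite derive1E; have [_ ->] := dexp t.
Qed.

End exponential_integrals.

Lemma affine_gt0 (R : realType) (b a t : R) : 0 < b -> 0 < b + a ->
  0 <= t -> t <= 1 -> 0 < b + a * t.
Proof. by move=> b0 ba0 t0 t1; have [a0|a0] := leP 0 a; nra. Qed.

Section inverse_affine_product.
Variables (R : realType) (a b d g : R).
Hypothesis disc : b * d - a * g != 0.

Let f (t : R) := ((b + a * t) * (g + d * t))^-1.
(** Partial fractions: [(b * d - a * g) * f t = d / (g + d * t) - a / (b + a * t)], whence this
    primitive of [f]. *)
Let F (t : R) := (b * d - a * g)^-1 * (ln (g + d * t) - ln (b + a * t)).

Let dF (t : R) : 0 < b + a * t -> 0 < g + d * t -> is_derive t 1 F (f t).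
Proof.
move=> p q.
have D1 := @is_derive1_comp _ _ (fun s => b + a * s) _ _ _
  (is_derive1_ln p) (is_derive_affine R b a t).
have D2 := @is_derive1_comp _ _ (fun s => g + d * s) _ _ _
  (is_derive1_ln q) (is_derive_affine R g d t).
have D := is_deriveZ (b * d - a * g)^-1 (is_deriveB D2 D1).
apply: (is_derive_eq D); rewrite /f /GRing.scale /=; field.
by rewrite disc !gt_eqF.
Qed.

Let df (t : R) : 0 < b + a * t -> 0 < g + d * t -> derivable f t 1.
Proof.
move=> p q; apply: derivableV; first by rewrite mulf_neq0 ?gt_eqF.
apply: derivableM; first by have [] := is_derive_affine R b a t.
by have [] := is_derive_affine R g d t.
Qed.

Lemma integral_inv_affine01 : 0 < b -> 0 < b + a -> 0 < g -> 0 < g + d ->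
  (\int[lebesgue_measure]_(t in `[0%R, 1%R])
     (((b + a * t) * (g + d * t))^-1)%:E =
   ((ln (b * (g + d)) - ln ((b + a) * g)) / (b * d - a * g))%:E)%E.
Proof.
move=> b0 ba0 g0 gd0.
have bat t : 0 <= t -> t <= 1 -> 0 < b + a * t by exact: affine_gt0.
have gdt t : 0 <= t -> t <= 1 -> 0 < g + d * t by exact: affine_gt0.
have cF : {within `[0%R, 1%R], continuous F}.
  apply: derivable_within_continuous => t; rewrite in_itv/= => /andP[t0 t1].
  by have [] := dF t (bat t t0 t1) (gdt t t0 t1).
rewrite (@continuous_FTC2 _ _ F) //.
- rewrite -EFinB /F !mulr0 !mulr1 !addr0 !lnM ?posrE//; congr EFin.
  by rewrite -mulrBr mulrC; congr (_ / _); ring.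
- apply: derivable_within_continuous => t; rewrite in_itv/= => /andP[t0 t1].
  by apply: df; [exact: bat|exact: gdt].
- split.
  + move=> t; rewrite in_itv/= => /andP[/ltW t0 /ltW t1].
    by have [] := dF t (bat t t0 t1) (gdt t t0 t1).
  + by move/continuous_within_itvP: cF => /(_ ltr01)[].
  + by move/continuous_within_itvP: cF => /(_ ltr01)[].
- move=> t; rewrite in_itv/= => /andP[/ltW t0 /ltW t1].
  by rewrite derive1E; have [_ ->] := dF t (bat t t0 t1) (gdt t t0 t1).
Qed.

Lemma integral_inv_affine0y : 0 < b -> 0 < a -> 0 < g -> 0 < d ->
  (\int[lebesgue_measure]_(t in `[0%R, +oo[)
     (((b + a * t) * (g + d * t))^-1)%:E =
   ((ln (b * d) - ln (a * g)) / (b * d - a * g))%:E)%E.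
Proof.
move=> b0 a0 g0 d0.
have bat t : 0 <= t -> 0 < b + a * t by move=> ?; nra.
have gdt t : 0 <= t -> 0 < g + d * t by move=> ?; nra.
have cF : {within `[0%R, +oo[, continuous F}.
  apply: derivable_within_continuous => t; rewrite in_itv/= andbT => t0.
  by have [] := dF t (bat t t0) (gdt t t0).
(* The limit of [F] at [+oo]: a factor [s] taken out of both affine forms cancels in the difference
   of logarithms. *)
pose l := (b * d - a * g)^-1 * (ln d - ln a).
rewrite (@ge0_continuous_FTC2y R f F 0 l).
- rewrite -EFinB /F /l !mulr0 !addr0 !lnM ?posrE//; congr EFin.
  by rewrite -mulrBr mulrC; congr (_ / _); ring.
- by move=> t t0; rewrite invr_ge0 mulr_ge0 ?ltW ?bat ?gdt.
- apply: derivable_within_continuous => t; rewrite in_itv/= andbT => t0.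
  by apply: df; [exact: bat|exact: gdt].
- apply: cvgMr.
  have lim p q : 0 < q -> (p / s + q) @[s --> +oo] --> (q : R).
    move=> q0; rewrite -[X in _ --> X]add0r; apply: cvgD; last exact: cvg_cst.
    rewrite -[X in _ --> X](mulr0 p); apply: cvgMr.
    by apply/gtr0_cvgV0; [exact: nbhs_pinfty_gt|exact: cvg_id].
  apply: (@cvg_trans _ ((ln (g / s + d) - ln (b / s + a)) @[s --> +oo])).
    apply: near_eq_cvg; near=> s.
    have s0 : 0 < s by near: s; exact: nbhs_pinfty_gt.
    have gE : g + d * s = s * (g / s + d) by field; rewrite gt_eqF.
    have bE : b + a * s = s * (b / s + a) by field; rewrite gt_eqF.
    rewrite gE bE !lnM ?posrE ?addr_gt0 ?divr_gt0//; ring.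
  apply: cvgB.
    by apply: continuous_cvg; [exact: continuous_ln|exact: lim].
  by apply: continuous_cvg; [exact: continuous_ln|exact: lim].
- by move=> t /ltW t0; have [] := dF t (bat t t0) (gdt t t0).
- by move/continuous_within_itvcyP: cF => [].
- move=> t; rewrite in_itv/= andbT => /ltW t0.
  by rewrite derive1E; have [_ ->] := dF t (bat t t0) (gdt t t0).
Unshelve. all: by end_near. Qed.

End inverse_affine_product.

(** * Termwise integration of a geometric series *)

Lemma geometric_remainder (R : realFieldType) (q : R) (N : nat) : q != 1 ->
  (1 - q)^-1 - \sum_(0 <= k < N) q ^+ k = q ^+ N / (1 - q).
Proof.
move=> q1; have q1' : 1 - q != 0 by rewrite subr_eq0 eq_sym.
elim: N => [|N IH]; first by rewrite big_geq// subr0 expr0 mul1r.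
rewrite big_nat_recr//= opprD addrA IH exprS.
by field.
Qed.

Section geometric_integral.
Context (d : measure_display) (T : measurableType d) (R : realType).
Variables (mu : {measure set T -> \bar R}) (D : set T) (mD : measurable D).
Variables (f w : T -> R) (t : nat -> R) (r : R).
Hypothesis mf : measurable_fun D f.
Hypothesis mw : measurable_fun D w.
Hypothesis f0 : forall x, D x -> 0 <= f x.
Hypothesis w0 : forall x, D x -> 0 <= w x.
Hypothesis w1 : forall x, D x -> w x <= 1.
Hypothesis fwE : forall n, (\int[mu]_(x in D) (f x * w x ^+ n)%:E = (t n)%:E)%E.
Hypothesis r1 : `|r| <= 1.
Hypothesis rw1 : r = 1 -> forall x, D x -> w x < 1.
Hypothesis rt : cvgn (series (fun n => r ^+ n * t n)).

Let g x := f x / (1 - r * w x).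

Let mg : measurable_fun D g.
Proof.
apply: measurable_funM => //; apply: (measurable_comp measurableT) => //.
  exact: measurable_inv.
by apply: measurable_funB => //; exact: measurable_funM.
Qed.

Let mfw n : measurable_fun D (fun x => f x * w x ^+ n).
Proof. by apply: measurable_funM => //; exact: measurable_funX. Qed.

Let fw0 n x : D x -> 0 <= f x * w x ^+ n.
Proof. by move=> Dx; rewrite mulr_ge0 ?f0// exprn_ge0// w0. Qed.

Let integrable_fw n : mu.-integrable D (EFin \o (fun x => f x * w x ^+ n)).
Proof.
apply/integrableP; split; first exact/measurable_EFinP.
rewrite (eq_integral (fun x => (f x * w x ^+ n)%:E)) ?fwE ?ltry// => x.
by rewrite inE => Dx /=; rewrite ger0_norm// fw0.
Qed.

(** All terms are nonnegative, so monotone convergence exchanges sum and integral; finiteness of the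
    resulting value then yields integrability. *)
Lemma geometric_integral_pos : 0 < r ->
  mu.-integrable D (fun x => (f x / (1 - r * w x))%:E) /\
  (\int[mu]_(x in D) (f x / (1 - r * w x))%:E =
   (limn (series (fun n => r ^+ n * t n)))%:E)%E.
Proof.
move=> r0.
(* The denominator stays positive: for [r < 1] because [0 <= w x <= 1], for [r = 1] by [rw1]. *)
have q1 x : D x -> r * w x < 1.
  move=> Dx; have := le_trans (ler_norm r) r1.
  rewrite le_eqVlt => /predU1P[rE|r_lt1]; first by rewrite rE mul1r; exact: rw1.
  by have := w0 _ Dx; have := w1 _ Dx; nra.
have g0 x : D x -> 0 <= g x.
  by move=> Dx; rewrite divr_ge0 ?f0// subr_ge0 ltW// q1.
have gE x : D x -> (g x)%:E = (\sum_(0 <= n <oo) ((r ^+ n)%:E * (f x * w x ^+ n)%:E))%E.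
  move=> Dx; apply/esym/cvg_lim => //.
  have -> : (fun n => \sum_(0 <= i < n) (r ^+ i)%:E * (f x * w x ^+ i)%:E)%E =
            EFin \o series (geometric (f x) (r * w x)).
    apply/funext => n /=; rewrite -sumEFin; apply: eq_bigr => i _.
    by rewrite -EFinM /= exprMn; congr EFin; ring.
  apply: cvg_EFin; first exact: nearW.
  by apply: cvg_geometric_series; rewrite ger0_norm ?q1// mulr_ge0 ?w0// ltW.
have iE : (\int[mu]_(x in D) (g x)%:E = (limn (series (fun n => r ^+ n * t n)))%:E)%E.
  rewrite (eq_integral (fun x => (\sum_(0 <= n <oo) ((r ^+ n)%:E * (f x * w x ^+ n)%:E))%E)); last first.
    by move=> x; rewrite inE => /gE.
  rewrite integral_nneseries//; last 2 first.
  - by move=> n; apply: measurable_funeM; exact/measurable_EFinP.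
  - by move=> n x Dx; rewrite -EFinM lee_fin mulr_ge0 ?exprn_ge0 ?fw0// ltW.
  apply/cvg_lim => //.
  have -> : (fun n => \sum_(0 <= i < n) \int[mu]_(x in D) ((r ^+ i)%:E * (f x * w x ^+ i)%:E))%E =
            EFin \o series (fun n => r ^+ n * t n).
    apply/funext => n /=; rewrite -sumEFin; apply: eq_bigr => i _.
    by rewrite (integralZl mD (integrable_fw _)) fwE -EFinM.
  by apply: cvg_EFin; [exact: nearW|].
split => //; apply/integrableP; split; first exact/measurable_EFinP.
rewrite (eq_integral (fun x => (g x)%:E)) ?iE ?ltry// => x.
by rewrite inE => Dx /=; rewrite ger0_norm// g0.
Qed.

(** The denominator is at least [1], so [g] is dominated by [f], the integrand of [t 0]. After [N]
    terms the exact remainder is [r ^+ N * (g x * w x ^+ N)]; replacing [g] by [f] bounds its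
    integral by the modulus of the general term of a convergent series. *)
Lemma geometric_integral_neg : r <= 0 ->
  mu.-integrable D (fun x => (f x / (1 - r * w x))%:E) /\
  (\int[mu]_(x in D) (f x / (1 - r * w x))%:E =
   (limn (series (fun n => r ^+ n * t n)))%:E)%E.
Proof.
move=> r0.
have q1 x : D x -> 1 <= 1 - r * w x.
  by move=> Dx; have := w0 _ Dx; nra.
have g0 x : D x -> 0 <= g x.
  by move=> Dx; rewrite divr_ge0 ?f0// (le_trans _ (q1 _ Dx)).
have gf x : D x -> g x <= f x.
  move=> Dx; rewrite ler_pdivrMr ?(lt_le_trans _ (q1 _ Dx))//.
  by rewrite ler_peMr ?f0 ?q1.
have ig : mu.-integrable D (EFin \o g).
  apply: le_integrable (integrable_fw 0) => //; first exact/measurable_EFinP.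
  move=> x Dx /=; rewrite expr0 mulr1 lee_fin !ger0_norm ?f0 ?g0//.
  exact: gf.
split=> //.
have ifin : (\int[mu]_(x in D) (g x)%:E)%E \is a fin_num.
  exact: (integrable_fin_num mD ig).
pose S := fine (\int[mu]_(x in D) (g x)%:E)%E.
have SE : (\int[mu]_(x in D) (g x)%:E)%E = S%:E by rewrite fineK.
rewrite SE; congr EFin; apply/esym/cvg_lim => //.
have bnd N : `|S - series (fun n => r ^+ n * t n) N| <= `|r ^+ N * t N|.
  have iS : mu.-integrable D (fun x => \sum_(0 <= k < N) (r ^+ k)%:E * (f x * w x ^+ k)%:E)%E.
    by apply: integrable_sum => // k _; exact: (integrableZl mD _ (integrable_fw k)).
  have sE : (\int[mu]_(x in D) \sum_(0 <= k < N) ((r ^+ k)%:E * (f x * w x ^+ k)%:E)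
       = (series (fun n => r ^+ n * t n) N)%:E)%E.
    rewrite integral_sum//; last by move=> k; exact: (integrableZl mD _ (integrable_fw k)).
    rewrite -sumEFin; apply: eq_bigr => k _.
    by rewrite (integralZl mD (integrable_fw _)) fwE -EFinM.
  rewrite -lee_fin -abse_EFin EFinB -SE -sE -integralB//.
  apply: (le_trans (le_abse_integral _ mD _)).
    by apply: emeasurable_funB; [exact/measurable_EFinP|exact: measurable_int iS].
  rewrite normrM [`|t N|]ger0_norm; last first.
    by rewrite -lee_fin -fwE; apply: integral_ge0 => x Dx; rewrite lee_fin fw0.
  rewrite EFinM -fwE -(integralZl mD (integrable_fw N)).
  apply: ge0_le_integral => //.
  - apply: measurableT_comp => //.
    by apply: emeasurable_funB; [exact/measurable_EFinP|exact: measurable_int iS].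
  - by apply: measurable_funeM; exact/measurable_EFinP.
  - move=> x Dx.
    have qn1 : r * w x != 1.
      by rewrite -subr_eq0 -oppr_eq0 opprB gt_eqF// (lt_le_trans _ (q1 _ Dx)).
    under eq_bigr do rewrite -EFinM.
    rewrite sumEFin -EFinB abse_EFin -EFinM lee_fin.
    have -> : g x - \sum_(0 <= i < N) r ^+ i * (f x * w x ^+ i) =
        r ^+ N * (g x * w x ^+ N).
      transitivity (f x * ((1 - r * w x)^-1 - \sum_(0 <= k < N) (r * w x) ^+ k)).
        rewrite mulrBr mulr_sumr; congr (_ - _); apply: eq_bigr => k _.
        by rewrite exprMn; ring.
      by rewrite geometric_remainder// exprMn /g; ring.
    rewrite normrM ler_wpM2l// ger0_norm; last first.
      by rewrite mulr_ge0 ?g0 ?exprn_ge0 ?w0.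
    by rewrite ler_wpM2r ?exprn_ge0 ?w0// gf.
have cv0 := cvg_series_cvg_0 rt.
apply/cvgrPdist_le => e e0; near=> N; apply: le_trans (bnd N) _.
by near: N; exact: (cvgr0_norm_le _ cv0).
Unshelve. all: by end_near. Qed.

Lemma geometric_integral :
  mu.-integrable D (fun x => (f x / (1 - r * w x))%:E) /\
  (\int[mu]_(x in D) (f x / (1 - r * w x))%:E =
   (limn (series (fun n => r ^+ n * t n)))%:E)%E.
Proof.
have [r0|r0] := ltP 0 r; first exact: geometric_integral_pos.
exact: geometric_integral_neg.
Qed.

End geometric_integral.

(** * Growth of the terms *)

Lemma bernoulli_ineq (R : realFieldType) (s : R) (n : nat) : 1 <= s ->
  1 + n%:R * (s - 1) <= s ^+ n.
Proof.
move=> s1; elim: n => [|n IH]; first by rewrite mul0r addr0 expr0.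
rewrite exprS; apply: le_trans (ler_wpM2l (le_trans ler01 s1) IH).
rewrite -subr_ge0 -natr1.
have -> : s * (1 + n%:R * (s - 1)) - (1 + (n%:R + 1) * (s - 1)) =
  n%:R * (s - 1) ^+ 2 by ring.
by rewrite mulr_ge0// sqr_ge0.
Qed.

(** Geometric growth outweighs a decay no faster than quadratic. If [1 < |r|], its square root [s]
    also exceeds [1]; by Bernoulli [s ^+ n] grows at least linearly, so [|r| ^+ n = (s ^+ n) ^+ 2]
    grows at least quadratically and the terms stay away from [0]. *)
Lemma normr_le1_of_cvg0 (R : realType) (r K : R) (t : nat -> R) :
  0 < K -> (forall n, K / n.+1%:R ^+ 2 <= t n) ->
  (r ^+ n * t n) @[n --> \oo] --> 0 -> `|r| <= 1.
Proof.
move=> K0 tK /cvgr0_norm_lt cv; rewrite leNgt; apply/negP => r1.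
pose s := Num.sqrt `|r|.
have s1 : 1 < s by rewrite -sqrtr1 ltr_sqrt// (lt_trans _ r1).
have s2 : s ^+ 2 = `|r| by rewrite sqr_sqrtr.
(* In [e * (n + 1) <= 1 + n * (s - 1)], the bound [e <= 1] handles the constant and [e <= s - 1] the
   slope. *)
pose e := Num.min 1 (s - 1).
have e0 : 0 < e by rewrite lt_min ltr01 subr_gt0.
have es n : e * n.+1%:R <= s ^+ n.
  apply: le_trans (bernoulli_ineq R s n (ltW s1)).
  have : e <= 1 by rewrite ge_min lexx.
  have : e <= s - 1 by rewrite ge_min lexx orbT.
  have : 0 <= n%:R :> R by [].
  rewrite -natr1; nra.
have lb n : K * e ^+ 2 <= `|r ^+ n * t n|.
  rewrite normrM normrX -s2 -exprM mulnC exprM [leRHS]mulrC.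
  have n0 : 0 < n.+1%:R :> R by [].
  have tn0 : K / n.+1%:R ^+ 2 <= `|t n| by apply: le_trans (ler_norm _).
  have -> : K * e ^+ 2 = K / n.+1%:R ^+ 2 * (e * n.+1%:R) ^+ 2.
    by field; rewrite gt_eqF.
  apply: ler_pM => //; first by rewrite divr_ge0 ?ltW// exprn_gt0.
    by rewrite exprn_ge0// mulr_ge0// ltW.
  by rewrite ler_pXn2r ?nnegrE// ?exprn_ge0 ?mulr_ge0 ?sqrtr_ge0// ltW.
have [n _ /(_ n (leqnn n)) /=] := cv (K * e ^+ 2) (mulr_gt0 K0 (exprn_gt0 2 e0)).
by rewrite ltNge lb.
Qed.

(** For [q < p], the inequality [ln (q / p) <= q / p - 1] bounds the slope below by [1 / p], hence
    by [1 / (p + q)]. This weaker bound is symmetric, so it serves whichever point is larger. *)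
Lemma ln_slope_ge (R : realType) (u v : R) : 0 < u -> 0 < v -> u != v ->
  (u + v)^-1 <= (ln u - ln v) / (u - v).
Proof.
have slope (p q : R) : 0 < q -> q < p -> (p + q)^-1 <= (ln p - ln q) / (p - q).
  move=> q0 qp; have p0 := lt_trans q0 qp.
  rewrite ler_pdivlMr ?subr_gt0//.
  have := @le_ln1Dx R (q / p - 1).
  rewrite addrCA subrr addr0 ltrBDl subrr divr_gt0// => /(_ isT).
  rewrite ln_div ?posrE// => h.
  have pq : (p + q)^-1 <= p^-1 by rewrite lef_pV2 ?posrE ?addr_gt0// lerDl ltW.
  apply: (@le_trans _ _ (p^-1 * (p - q))).
    by rewrite ler_wpM2r// subr_ge0 ltW.
  have -> : p^-1 * (p - q) = 1 - q / p by field; rewrite gt_eqF.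
  by lra.
move=> u0 v0; rewrite neq_lt => /orP[uv|vu]; last exact: slope.
by rewrite addrC -opprB -(opprB v) invrN mulrNN; exact: slope.
Qed.

(** * Iterated integrals over rectangles *)

Section integral_setX.
Context (d1 d2 : measure_display) (T1 : measurableType d1)
  (T2 : measurableType d2) (R : realType).
Variable m1 : {sigma_finite_measure set T1 -> \bar R}.
Variable m2 : {sigma_finite_measure set T2 -> \bar R}.
Variables (D1 : set T1) (D2 : set T2).
Hypotheses (mD1 : measurable D1) (mD2 : measurable D2).
Variable f : T1 * T2 -> \bar R.

(** Extension of [f] by zero to the whole product. Its partial integrals are the zero extensions of
    those of [f], so Fubini and Tonelli on the product carry over to the rectangle. *)
Let fX := f \_ (D1 `*` D2).

Let fubini_FX x : fubini_F m2 fX x =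
  ((fun x => \int[m2]_(y in D2) f (x, y)) \_ D1)%E x.
Proof.
rewrite /fubini_F /fX patchE; case: ifPn => xD1.
  rewrite [in RHS]integral_mkcond; apply: eq_integral => y _.
  by rewrite !patchE in_setX/= xD1.
by apply: integral0_eq => y _; rewrite patchE in_setX/= (negbTE xD1).
Qed.

Let fubini_GX y : fubini_G m1 fX y =
  ((fun y => \int[m1]_(x in D1) f (x, y)) \_ D2)%E y.
Proof.
rewrite /fubini_G /fX patchE; case: ifPn => yD2.
  rewrite [in RHS]integral_mkcond; apply: eq_integral => x _.
  by rewrite !patchE in_setX/= yD2 andbT.
by apply: integral0_eq => x _; rewrite patchE in_setX/= (negbTE yD2) andbF.
Qed.

Lemma integral12_setX : (m1 \x m2)%E.-integrable (D1 `*` D2) f ->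
  measurable_fun D1 (fun x => \int[m2]_(y in D2) f (x, y))%E /\
  (\int[m1]_(x in D1) \int[m2]_(y in D2) f (x, y) =
   \int[m1 \x m2]_(p in D1 `*` D2) f p)%E.
Proof.
move=> /integrable_mkcond ifX; have {}ifX := ifX (measurableX mD1 mD2).
split.
  apply/(measurable_restrictT _ mD1); rewrite -(funext fubini_FX).
  by apply: measurable_fubini_F; exact: ifX.
rewrite integral_mkcond -(eq_integral _ _ (fun x _ => fubini_FX x)).
by rewrite integral12_prod_meas1// -integral_mkcond.
Qed.

Hypothesis mf : measurable_fun (D1 `*` D2) f.
Hypothesis f0 : forall p, (D1 `*` D2) p -> (0 <= f p)%E.

Let mfX : measurable_fun setT fX.
Proof. exact: (proj1 (measurable_restrictT f (measurableX mD1 mD2))). Qed.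

Let fX0 p : (0 <= fX p)%E.
Proof. by rewrite /fX patchE; case: ifPn => //; rewrite inE => /f0. Qed.

Lemma ge0_integral12_setX :
  (\int[m1 \x m2]_(p in D1 `*` D2) f p =
   \int[m1]_(x in D1) \int[m2]_(y in D2) f (x, y))%E.
Proof.
rewrite [in LHS]integral_mkcond fubini_tonelli1//.
by rewrite [RHS]integral_mkcond; apply: eq_integral => x _; exact: fubini_FX.
Qed.

Lemma ge0_integral_setX_swap :
  (\int[m1]_(x in D1) \int[m2]_(y in D2) f (x, y) =
   \int[m2]_(y in D2) \int[m1]_(x in D1) f (x, y))%E.
Proof.
rewrite -ge0_integral12_setX integral_mkcond fubini_tonelli2//.
by rewrite [RHS]integral_mkcond; apply: eq_integral => x _; exact: fubini_GX.
Qed.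

Lemma ge0_measurable_integral_setX :
  measurable_fun D1 (fun x => \int[m2]_(y in D2) f (x, y))%E.
Proof.
apply/(measurable_restrictT _ mD1); rewrite -(funext fubini_FX).
exact: measurable_fun_fubini_tonelli_F.
Qed.

End integral_setX.

(** * Moments over the unit square *)

Section moments.
Variables (R : realType) (J : set R) (mJ : measurable J).
Variables (a b d g : R).
Hypothesis bJ : forall t, J t -> 0 < b + a * t.
Hypothesis gJ : forall t, J t -> 0 < g + d * t.

Local Notation mu := (@lebesgue_measure R).
Local Notation I := (`]0%R, 1%R[%classic : set R).

(** For [x > 0] this exponential is [x] to the power [p - 1 + q * t]; written through [ln] it is
    visibly measurable in the pair [(x, t)], as Tonelli requires. *)
Let measurable_exp (p q : R) :
  measurable_fun [set: R * R] (fun z : R * R => expR ((p - 1 + q * z.2) * ln z.1)).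
Proof.
apply: (measurableT_comp (@measurable_expR R)); apply: measurable_funM.
  apply: measurable_funD; first exact: measurable_cst.
  by apply: measurable_funM; [exact: measurable_cst|exact: measurable_snd].
by apply: (measurableT_comp (@measurable_ln R)); exact: measurable_fst.
Qed.

Let integral_exp (p q t : R) : 0 < p + q * t ->
  (\int[mu]_(x in I) (expR ((p - 1 + q * t) * ln x))%:E = ((p + q * t)^-1)%:E)%E.
Proof.
move=> pq; rewrite -integral_powR01//; apply: eq_integral => x.
rewrite inE /= in_itv/= => /andP[x0 _]; rewrite powR_expR//.
by rewrite addrAC.
Qed.

(** Tonelli moves the integral over [t] outside, first past [x], then past [y]; the integrals of
    powers that remain inside give [1 / (b + a * t)] and [1 / (g + d * t)]. *)
Lemma integral_exp_affine :
  (\int[mu]_(y in I) \int[mu]_(x in I) \int[mu]_(t in J)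
     (expR ((b - 1 + a * t) * ln x) * expR ((g - 1 + d * t) * ln y))%:E =
   \int[mu]_(t in J) (((b + a * t) * (g + d * t))^-1)%:E)%E.
Proof.
transitivity (\int[mu]_(y in I) \int[mu]_(t in J)
    ((b + a * t)^-1 * expR ((g - 1 + d * t) * ln y))%:E)%E.
  apply: eq_integral => y _.
  rewrite (ge0_integral_setX_swap _ _ _ _ _ mu mu I J _ _
    (fun z => (expR ((b - 1 + a * z.2) * ln z.1) *
               expR ((g - 1 + d * z.2) * ln y))%:E)) //.
  - apply: eq_integral => t; rewrite inE => Jt.
    under eq_integral do rewrite /= mulrC EFinM.
    rewrite ge0_integralZl//; last first.
      apply/measurable_EFinP/measurable_funTS.
      apply: (measurableT_comp (@measurable_expR R)).
      by apply: measurable_funM => //; exact: measurable_ln.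
    by rewrite integral_exp ?bJ// -EFinM mulrC.
  - apply/measurable_EFinP/measurable_funTS; apply: measurable_funM.
      exact: measurable_exp.
    apply: (measurableT_comp (@measurable_expR R)); apply: measurable_funM => //.
    apply: measurable_funD => //.
    by apply: measurable_funM => //; exact: measurable_snd.
rewrite (ge0_integral_setX_swap _ _ _ _ _ mu mu I J _ _
  (fun z => ((b + a * z.2)^-1 * expR ((g - 1 + d * z.2) * ln z.1))%:E)) //.
- apply: eq_integral => t; rewrite inE => Jt.
  under eq_integral do rewrite /= EFinM.
  rewrite ge0_integralZl//; last 2 first.
  + apply/measurable_EFinP/measurable_funTS.
    apply: (measurableT_comp (@measurable_expR R)).
    by apply: measurable_funM => //; exact: measurable_ln.
  + by rewrite lee_fin invr_ge0 ltW// bJ.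
  by rewrite integral_exp ?gJ// -EFinM invfM.
- apply/measurable_EFinP/measurable_funTS; apply: measurable_funM; last first.
    exact: measurable_exp.
  apply: (measurableT_comp (@measurable_inv R)).
  apply: measurable_funD => //.
  by apply: measurable_funM => //; exact: measurable_snd.
- move=> p [_ Jp]; rewrite lee_fin mulr_ge0 ?expR_ge0//.
  by rewrite invr_ge0 ltW// bJ.
Qed.

(* [x0] is the solution of [x `^ a * y `^ d = 1], if any: there
   [(z - 1) / ln z] is [0 / 0 = 0] whereas the integral is [1]. *)
Variable phi : R -> R.
Hypothesis mphi : measurable_fun [set: R] phi.
Hypothesis phi_ge0 : forall x y, I x -> I y -> 0 <= phi (x `^ a * y `^ d).
Hypothesis phiE : forall y, I y -> exists x0 : R, forall x, I x -> x != x0 ->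
  (\int[mu]_(t in J) (expR (ln (x `^ a * y `^ d) * t))%:E =
   (phi (x `^ a * y `^ d))%:E)%E.

Lemma measurable_powR_numerator (p q : R) : measurable_fun [set: R * R]
  (fun z : R * R => z.2 `^ p * z.1 `^ q * phi (z.2 `^ a * z.1 `^ d)).
Proof.
have mp s : measurable_fun [set: R * R] (fun z : R * R => z.2 `^ s).
  by apply: (measurableT_comp (@measurable_powR R s)); exact: measurable_snd.
have mq s : measurable_fun [set: R * R] (fun z : R * R => z.1 `^ s).
  by apply: (measurableT_comp (@measurable_powR R s)); exact: measurable_fst.
apply: measurable_funM; first exact: measurable_funM.
by apply: (measurableT_comp mphi); exact: measurable_funM.
Qed.

(** Replacing [phi] by its integral representation leads to [integral_exp_affine]. For each [y] the
    representation may fail at one point [x0], which is deleted from both inner integrals as a null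
    set. *)
Lemma integral_powR_numerator :
  (\int[mu \x mu]_(z in I `*` I)
     (z.2 `^ (b - 1) * z.1 `^ (g - 1) * phi (z.2 `^ a * z.1 `^ d))%:E =
   \int[mu]_(t in J) (((b + a * t) * (g + d * t))^-1)%:E)%E.
Proof.
rewrite ge0_integral12_setX //=; last 2 first.
- by apply/measurable_EFinP/measurable_funTS; exact: measurable_powR_numerator.
- by move=> z [? ?]; rewrite lee_fin !mulr_ge0 ?powR_ge0 ?phi_ge0.
rewrite -integral_exp_affine; apply: eq_integral => y; rewrite inE => Iy.
have y0 : 0 < y by move: Iy; rewrite /= in_itv/= => /andP[].
have [x0 phiyE] := phiE y Iy.
(* The inner integrand on the right; deleting [x0] from its domain requires its measurability. *)
pose h x := (\int[mu]_(t in J)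
  (expR ((b - 1 + a * t) * ln x) * expR ((g - 1 + d * t) * ln y))%:E)%E.
have mh : measurable_fun I h.
  apply: (ge0_measurable_integral_setX _ _ _ _ _ mu I J _ _
    (fun z => (expR ((b - 1 + a * z.2) * ln z.1) *
               expR ((g - 1 + d * z.2) * ln y))%:E)) => //.
  - apply/measurable_EFinP/measurable_funTS; apply: measurable_funM.
      exact: measurable_exp.
    apply: (measurableT_comp (@measurable_expR R)); apply: measurable_funM => //.
    apply: measurable_funD => //.
    by apply: measurable_funM => //; exact: measurable_snd.
have mI0 : measurable (I `\ x0) by exact: measurableD.
rewrite -[LHS](@integral_setD1 R _ x0)//; last first.
  apply/measurable_EFinP/measurable_funTS.
  by have := measurable_fun_pair2 y (measurable_powR_numerator (b - 1) (g - 1)).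
rewrite -[RHS](@integral_setD1 R _ x0)//; last first.
  by apply: measurable_funS mh => //; exact: subDsetl.
apply: eq_integral => x; rewrite inE => -[Ix /eqP xx0].
have x_gt0 : 0 < x by move: Ix; rewrite /= in_itv/= => /andP[].
rewrite EFinM -phiyE// -ge0_integralZl//=; last 2 first.
- apply/measurable_EFinP/measurable_funTS.
  apply: (measurableT_comp (@measurable_expR R)).
  by apply: measurable_funM.
- by rewrite lee_fin mulr_ge0 ?powR_ge0.
apply: eq_integral => t _; rewrite -EFinM; congr EFin.
rewrite lnM ?posrE ?powR_gt0// !ln_powR !powR_expR// -!expRD.
by congr expR; ring.
Qed.

End moments.

(** * Series expansion of the double integral *)

Section powR_kernel.
Variables (R : realType) (J : set R) (mJ : measurable J).
Variables (a b c d g h r : R) (phi : R -> R) (t : nat -> R) (K : R).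

Local Notation mu := (@lebesgue_measure R).
Local Notation I := (`]0%R, 1%R[%classic : set R).

Hypotheses (c0 : 0 <= c) (h0 : 0 <= h).
Hypothesis bJ : forall s, J s -> 0 < b + a * s.
Hypothesis gJ : forall s, J s -> 0 < g + d * s.
Hypothesis mphi : measurable_fun [set: R] phi.
Hypothesis phi_ge0 : forall x y, I x -> I y -> 0 <= phi (x `^ a * y `^ d).
Hypothesis phiE : forall y, I y -> exists x0 : R, forall x, I x -> x != x0 ->
  (\int[mu]_(s in J) (expR (ln (x `^ a * y `^ d) * s))%:E =
   (phi (x `^ a * y `^ d))%:E)%E.
Hypothesis tE : forall n : nat, (\int[mu]_(s in J)
  (((b + c * n%:R + a * s) * (g + h * n%:R + d * s))^-1)%:E = (t n)%:E)%E.
Hypothesis K0 : 0 < K.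
Hypothesis Kt : forall n : nat, K / n.+1%:R ^+ 2 <= t n.
Hypothesis rt : cvgn (series (fun n => r ^+ n * t n)).

(* Points of the square are pairs [(y, x)], matching the outer integral over [y]. *)
Definition powR_kernel (z : R * R) := z.2 `^ (b - 1) * z.1 `^ (g - 1) *
  phi (z.2 `^ a * z.1 `^ d) / (1 - r * (z.2 `^ c * z.1 `^ h)).

(** An instance of [geometric_integral] with [w] the monomial of exponents [c] and [h]: a factor
    [w ^+ n] only shifts [b] to [b + c * n] and [g] to [g + h * n], so every moment is given by
    [integral_powR_numerator]. *)
Lemma integral_powR_kernel_series :
  (mu \x mu)%E.-integrable (I `*` I) (EFin \o powR_kernel) /\
  (\int[mu \x mu]_(z in I `*` I) (powR_kernel z)%:E =
   (limn (series (fun n => r ^+ n * t n)))%:E)%E.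
Proof.
have mI : measurable I by exact: measurable_itv.
have cv0 := cvg_series_cvg_0 rt.
have I01 x : I x -> 0 < x /\ x < 1 by rewrite /= in_itv/= => /andP[].
have IP z : (I `*` I) z -> [/\ 0 < z.1, z.1 < 1, 0 < z.2 & z.2 < 1].
  by move=> [/I01[? ?] /I01[? ?]].
have wE z : (I `*` I) z -> z.2 `^ c * z.1 `^ h = expR (c * ln z.2 + h * ln z.1).
  by move=> /IP[? _ ? _]; rewrite !powR_expR// expRD.
have mII : measurable (I `*` I) by exact: measurableX.
apply: (geometric_integral _ _ R (mu \x mu)%E (I `*` I) mII
  (fun z => z.2 `^ (b - 1) * z.1 `^ (g - 1) * phi (z.2 `^ a * z.1 `^ d))
  (fun z => z.2 `^ c * z.1 `^ h) t r).
- by apply: measurable_funTS; exact: (measurable_powR_numerator R a d phi mphi).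
- apply: measurable_funTS; apply: measurable_funM.
    by apply: (measurableT_comp (@measurable_powR R c)); exact: measurable_snd.
  by apply: (measurableT_comp (@measurable_powR R h)); exact: measurable_fst.
- by move=> z [? ?]; rewrite !mulr_ge0 ?powR_ge0 ?phi_ge0.
- by move=> z _; rewrite mulr_ge0 ?powR_ge0.
- move=> z Iz; have [z10 z11 z20 z21] := IP z Iz.
  by rewrite wE// expR_le1 -[leRHS]addr0 lerD// mulr_ge0_le0// ln_le0// ltW.
- move=> n; rewrite -tE -(integral_powR_numerator R J mJ a _ d _ _ _ phi)//; first last.
  + by move=> s Js; rewrite addrAC ltr_wpDr ?gJ// mulr_ge0.
  + by move=> s Js; rewrite addrAC ltr_wpDr ?bJ// mulr_ge0.
  apply: eq_integral => z; rewrite inE => Iz; have [z10 _ z20 _] := IP z Iz.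
  rewrite wE// !(powR_expR _ _ (b - 1)) ?(powR_expR _ _ (g - 1)) //.
  rewrite (powR_expR _ _ (b + c * n%:R - 1)) ?(powR_expR _ _ (g + h * n%:R - 1)) //.
  rewrite -expRM_natl mulrAC -!expRD; congr ((expR _ * _)%:E).
  ring.
- exact: normr_le1_of_cvg0 K0 Kt cv0.
- move=> r1 z Iz; have [z10 z11 z20 z21] := IP z Iz.
  have l1 : ln z.1 < 0 by rewrite ln_lt0// z10.
  have l2 : ln z.2 < 0 by rewrite ln_lt0// z20.
  rewrite wE// expR_lt1.
  (* On the open square [w < 1] unless [c = h = 0]. In that case [t] is constant, and for [r = 1]
     convergence would force [t 0 = 0], against [Kt]. *)
  move: c0 h0; rewrite !le_eqVlt => /predU1P[cE|c_gt0] /predU1P[hE|h_gt0].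
  + have tc n : t n = t 0%N.
      apply: EFin_inj; rewrite -!tE; apply: eq_integral => s _.
      by rewrite -cE -hE !mul0r.
    have : (fun n => r ^+ n * t n) = fun=> t 0%N.
      by apply/funext => n; rewrite r1 expr1n mul1r tc.
    move=> tcst; move: cv0; rewrite tcst => /(cvg_lim (@Rhausdorff R)).
    rewrite lim_cst => // t00; have := Kt 0%N.
    by rewrite t00 expr1n divr1 leNgt K0.
  + by rewrite -cE mul0r add0r nmulr_llt0.
  + by rewrite -hE mul0r addr0 nmulr_llt0.
  + by rewrite -[ltRHS]addr0 ltrD// nmulr_llt0.
- exact: rt.
Qed.

End powR_kernel.

(** * Passage from the closed square to the open one *)

(** [G] has to agree with [F] only inside the open square, since endpoints are null in each
    variable; integrability of [F] then lets Fubini join the two integrals. *)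
Lemma integral_unit_square (R : realType) (G : R -> R -> R) (F : R * R -> R) :
  (forall x y, `]0%R, 1%R[%classic x -> `]0%R, 1%R[%classic y -> G x y = F (y, x)) ->
  measurable_fun [set: R * R] F ->
  (@lebesgue_measure R \x @lebesgue_measure R)%E.-integrable
    (`]0%R, 1%R[ `*` `]0%R, 1%R[) (EFin \o F) ->
  (\int[lebesgue_measure]_(y in `[0%R, 1%R]) \int[lebesgue_measure]_(x in `[0%R, 1%R])
     (G x y)%:E =
   \int[lebesgue_measure \x lebesgue_measure]_(z in `]0%R, 1%R[ `*` `]0%R, 1%R[)
     (F z)%:E)%E.
Proof.
move=> GF mF iF.
have mI : measurable (`]0%R, 1%R[%classic : set R) by exact: measurable_itv.
have [mFy <-] := integral12_setX _ _ _ _ R lebesgue_measure lebesgue_measure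
  _ _ mI mI (EFin \o F) iF.
have inner y : `]0%R, 1%R[%classic y ->
  (\int[lebesgue_measure]_(x in `[0%R, 1%R]) (G x y)%:E =
   \int[lebesgue_measure]_(x in `]0%R, 1%R[) (F (y, x))%:E)%E.
  move=> Iy; rewrite integral_itv_bndoo.
    by apply: eq_integral => x; rewrite inE => Ix; rewrite GF.
  apply: (eq_measurable_fun (fun x => (F (y, x))%:E)).
    by move=> x; rewrite inE => Ix; rewrite GF.
  apply/measurable_EFinP/measurable_funTS.
  exact: (measurable_fun_pair2 y mF).
rewrite integral_itv_bndoo.
  by apply: eq_integral => y; rewrite inE => /inner.
apply: (eq_measurable_fun (fun y =>
  \int[lebesgue_measure]_(x in `]0%R, 1%R[) (F (y, x))%:E)%E) => //.
by move=> y; rewrite inE => /inner.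
Qed.

(** * The two kernels on the open square *)

Lemma affine_nat_le (R : realType) (p q : R) (n : nat) : 0 <= p -> 0 <= q ->
  p + q * n%:R <= (p + q) * n.+1%:R.
Proof.
move=> p0 q0; rewrite -natr1 -subr_ge0.
have -> : (p + q) * (n%:R + 1) - (p + q * n%:R) = p * n%:R + q by ring.
by rewrite addr_ge0// mulr_ge0.
Qed.

(** Supplies the lower bound [Kt] with [K = M^-1]: the coefficients of both series are difference
    quotients of [ln] at points growing at most quadratically in [n]. *)
Lemma ln_slope_quadratic_bound (R : realType) (M u v : R) (n : nat) :
  0 < u -> 0 < v -> u != v -> u + v <= M * n.+1%:R ^+ 2 ->
  M^-1 / n.+1%:R ^+ 2 <= (ln u - ln v) / (u - v).
Proof.
move=> u0 v0 uv uvM; apply: le_trans (ln_slope_ge R u v u0 v0 uv).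
by rewrite -invfM lef_pV2 ?posrE ?addr_gt0// (lt_le_trans _ uvM)// addr_gt0.
Qed.

Lemma ln_monomial (R : realType) (a d x y : R) : 0 < x -> 0 < y ->
  ln (x `^ a * y `^ d) = a * ln x + d * ln y.
Proof. by move=> x0 y0; rewrite lnM ?posrE ?powR_gt0// !ln_powR. Qed.

(** For positive [a] and [d] the logarithm is negative on the open square, so [- (ln z)^-1] is the
    integral of the powers of [z] over [J = [0, +oo[]. *)
Lemma integral_square_term1_pos (R : realType) (a b c d g h r : R) :
  0 < a -> 0 < d -> 0 < b -> 0 <= c -> 0 < g -> 0 <= h ->
  (forall n : nat, - a * (h * n%:R + g) + b * d + c * d * n%:R != 0) ->
  cvgn (series (term1 a b c d g h r)) ->
  (@lebesgue_measure R \x @lebesgue_measure R)%E.-integrable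
    (`]0%R, 1%R[ `*` `]0%R, 1%R[)
    (EFin \o powR_kernel R a b c d g h r (fun z => - (ln z)^-1)) /\
  (\int[lebesgue_measure \x lebesgue_measure]_(z in `]0%R, 1%R[ `*` `]0%R, 1%R[)
     (powR_kernel R a b c d g h r (fun z => - (ln z)^-1) z)%:E =
   (limn (series (term1 a b c d g h r)))%:E)%E.
Proof.
move=> a0 d0 b0 c0 g0 h0 disc.
pose t n : R := (ln ((b + c * n%:R) * d) - ln (a * (g + h * n%:R))) /
  ((b + c * n%:R) * d - a * (g + h * n%:R)).
have n0 n : 0 <= n%:R :> R by [].
have B0 n : 0 < b + c * n%:R by rewrite ltr_wpDr// mulr_ge0.
have G0 n : 0 < g + h * n%:R by rewrite ltr_wpDr// mulr_ge0.
have disc' n : (b + c * n%:R) * d - a * (g + h * n%:R) != 0.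
  by have := disc n; congr (_ != 0); ring.
have -> : term1 a b c d g h r = fun n => r ^+ n * t n.
  apply/funext => n; rewrite /term1 /t [h * _ + g]addrC [c * _ + b]addrC.
  rewrite !ln_div ?posrE// !lnM ?posrE//; congr (_ * (_ / _)); ring.
move=> rt.
have lnI (x y : R) : `]0%R, 1%R[%classic x -> `]0%R, 1%R[%classic y ->
    ln (x `^ a * y `^ d) < 0.
  rewrite /= !in_itv/= => /andP[x0 x1] /andP[y0 y1]; rewrite ln_monomial//.
  rewrite -[ltRHS]addr0 ltrD// nmulr_llt0 ?ln_lt0// ?x0 ?y0//.
(* Here [u + v <= M * (n + 1)], a linear bound that is then weakened to the quadratic one. *)
pose M := (b + c) * d + a * (g + h).
apply: (integral_powR_kernel_series R `[0%R, +oo[%classic _ a b c d g h r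
  (fun z => - (ln z)^-1) t M^-1) => //.
- by move=> s; rewrite /= in_itv/= andbT => s0; rewrite ltr_wpDr// mulr_ge0// ltW.
- by move=> s; rewrite /= in_itv/= andbT => s0; rewrite ltr_wpDr// mulr_ge0// ltW.
- apply: (measurableT_comp (@oppr_measurable R setT)).
  by apply: (measurableT_comp (@measurable_inv R)); exact: measurable_ln.
- by move=> x y Ix Iy; rewrite oppr_ge0 invr_le0 ltW// lnI.
(* The logarithm never vanishes here, so no point of the interval is exceptional; [0] lies outside
   it. *)
- move=> y Iy; exists 0 => x Ix _; have l0 := lnI x y Ix Iy.
  by rewrite integral_expR0y// lt_eqF.
- by move=> n; rewrite integral_inv_affine0y.
- by rewrite invr_gt0 addr_gt0// mulr_gt0// ltr_wpDr.
- move=> n; apply: ln_slope_quadratic_bound; rewrite ?mulr_gt0//.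
    by rewrite -subr_eq0.
  have := affine_nat_le R b c n (ltW b0) c0.
  have := affine_nat_le R g h n (ltW g0) h0.
  move=> gh bc; apply: (@le_trans _ _ (M * n.+1%:R)).
    have -> : M * n.+1%:R = (b + c) * n.+1%:R * d + a * ((g + h) * n.+1%:R).
      by rewrite /M; ring.
    by rewrite lerD ?ler_pM2l ?ler_pM2r.
  rewrite ler_pM2l; last by rewrite addr_gt0// mulr_gt0// ltr_wpDr.
  by rewrite expr2 ler_peMr// ler1n.
Qed.

(** With [J = [0, 1]] the signs of [a] and [d] are free: positivity of [b + a * s] and [e + d * s]
    on [J] follows from the endpoints [s = 0] and [s = 1]. *)
Lemma integral_square_term2 (R : realType) (a b c d e h r : R) :
  0 < b -> 0 <= c -> 0 < e -> 0 <= h -> 0 < a + b -> 0 < d + e ->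
  (forall n : nat, b * d - a * e + c * d * n%:R - a * h * n%:R != 0) ->
  cvgn (series (term2 a b c d e h r)) ->
  (@lebesgue_measure R \x @lebesgue_measure R)%E.-integrable
    (`]0%R, 1%R[ `*` `]0%R, 1%R[)
    (EFin \o powR_kernel R a b c d e h r (fun z => (z - 1) / ln z)) /\
  (\int[lebesgue_measure \x lebesgue_measure]_(z in `]0%R, 1%R[ `*` `]0%R, 1%R[)
     (powR_kernel R a b c d e h r (fun z => (z - 1) / ln z) z)%:E =
   (limn (series (term2 a b c d e h r)))%:E)%E.
Proof.
move=> b0 c0 e0 h0 ab0 de0 disc.
pose B (n : nat) : R := b + c * n%:R.
pose E (n : nat) : R := e + h * n%:R.
have B0 n : 0 < B n by rewrite ltr_wpDr// mulr_ge0.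
have E0 n : 0 < E n by rewrite ltr_wpDr// mulr_ge0.
have BaE n : B n + a = (a + b) + c * n%:R by rewrite /B; ring.
have EdE n : E n + d = (d + e) + h * n%:R by rewrite /E; ring.
have Ba0 n : 0 < B n + a by rewrite BaE ltr_wpDr// mulr_ge0.
have Ed0 n : 0 < E n + d by rewrite EdE ltr_wpDr// mulr_ge0.
have disc' n : B n * d - a * E n != 0.
  by have := disc n; congr (_ != 0); rewrite /B /E; ring.
pose t n : R := (ln (B n * (E n + d)) - ln ((B n + a) * E n)) /
  (B n * d - a * E n).
have -> : term2 a b c d e h r = fun n => r ^+ n * t n.
  apply/funext => n; rewrite /term2 /t -BaE -EdE.
  rewrite -/(B n) -/(E n) ln_div ?posrE ?mulr_gt0//.
  by congr (_ * (_ / _)); rewrite /B /E; ring.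
move=> rt.
(* Both [u] and [v] are products of two factors affine in [n]; bounding each factor by a multiple of
   [n + 1] gives [u + v <= M * (n + 1) ^+ 2]. *)
pose M := (b + c) * (d + e + h) + (a + b + c) * (e + h).
apply: (integral_powR_kernel_series R `[0%R, 1%R]%classic _ a b c d e h r
  (fun z => (z - 1) / ln z) t M^-1) => //.
- move=> s; rewrite /= in_itv/= => /andP[s0 s1].
  by rewrite affine_gt0// addrC.
- move=> s; rewrite /= in_itv/= => /andP[s0 s1].
  by rewrite affine_gt0// addrC.
- apply: measurable_funM; first exact: measurable_funB.
  by apply: (measurableT_comp (@measurable_inv R)); exact: measurable_ln.
- move=> x y; rewrite /= !in_itv/= => /andP[x0 _] /andP[y0 _].
  have [z1|z1] := leP 1 (x `^ a * y `^ d).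
    by rewrite divr_ge0 ?ln_ge0// subr_ge0.
  by rewrite -mulrNN -invrN divr_ge0 ?oppr_ge0 ?subr_le0 ?ln_le0 ?ltW.
- move=> y; rewrite /= in_itv/= => /andP[y0 y1].
  have ly : ln y < 0 by rewrite ln_lt0// y0.
  (* For [a != 0] this is the root in [x] of [a * ln x + d * ln y = 0]. For [a = 0], [disc] at [0]
     forces [d != 0], and the logarithm [d * ln y] never vanishes. *)
  exists (expR (- (d / a) * ln y)) => x; rewrite /= in_itv/= => /andP[x0 _] xx0.
  rewrite integral_expR01; first by rewrite lnK// posrE mulr_gt0 ?powR_gt0.
  rewrite ln_monomial//; have [aE|aN0] := eqVneq a 0.
    have dN0 : d != 0.
      by apply: contraNneq (disc 0%N) => ->; rewrite aE; apply/eqP; ring.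
    by rewrite aE mul0r add0r mulf_neq0 // lt_eqF.
  apply: contraNneq xx0 => lE; rewrite -[eqbLHS]lnK ?posrE//; apply/eqP.
  congr expR; apply: (mulfI aN0); rewrite -[LHS](addrK (d * ln y)) lE.
  by field.
- by move=> n; exact: (integral_inv_affine01 R a (B n) d (E n)).
- by rewrite invr_gt0 addr_gt0// mulr_gt0// ltr_wpDr// ltr_wpDr.
- move=> n.
  have uvE : B n * (E n + d) - (B n + a) * E n = B n * d - a * E n by ring.
  rewrite /t -uvE; apply: ln_slope_quadratic_bound; rewrite ?mulr_gt0//.
    by rewrite -subr_eq0 uvE.
  have := affine_nat_le R b c n (ltW b0) c0.
  have := affine_nat_le R e h n (ltW e0) h0.
  have := affine_nat_le R (a + b) c n (ltW ab0) c0.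
  have := affine_nat_le R (d + e) h n (ltW de0) h0.
  rewrite -BaE -EdE -/(B n) -/(E n) => le1 le2 le3 le4.
  have -> : M * n.+1%:R ^+ 2 =
      ((b + c) * n.+1%:R) * ((d + e + h) * n.+1%:R) +
      ((a + b + c) * n.+1%:R) * ((e + h) * n.+1%:R) by rewrite /M; ring.
  by rewrite lerD// ler_pM// ltW.
Qed.

Lemma measurable_powR_kernel (R : realType) (a b c d g h r : R) (phi : R -> R) :
  measurable_fun [set: R] phi ->
  measurable_fun [set: R * R] (powR_kernel R a b c d g h r phi).
Proof.
move=> mphi; apply: measurable_funM.
  exact: (measurable_powR_numerator R a d phi mphi).
apply: (measurableT_comp (@measurable_inv R)); apply: measurable_funB => //.
apply: measurable_funM => //; apply: measurable_funM.
  by apply: (measurableT_comp (@measurable_powR R c)); exact: measurable_snd.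
by apply: (measurableT_comp (@measurable_powR R h)); exact: measurable_fst.
Qed.

Theorem theorem2p1 (R : realType) (a b c d e g h r : R) :
  ((* standing domain conditions for the first identity *)
   0 < b -> 0 <= c -> 0 < g -> 0 <= h -> 0 < d / a ->
   (forall n : nat, - a * (h * n%:R + g) + b * d + c * d * n%:R != 0) ->
   (* the series converges *)
   cvgn (series (term1 a b c d g h r)) ->
   (- (\int[lebesgue_measure]_(y in `[0%R, 1%R]%classic)
         \int[lebesgue_measure]_(x in `[0%R, 1%R]%classic)
            (integrand1 a b c d g h r x y)%:E))%E
   = (limn (series (term1 a b c d g h r)))%:E)
  /\
  ((* standing domain conditions for the second identity *)
   0 < b -> 0 <= c -> 0 < e -> 0 <= h -> 0 < a + b -> 0 < d + e ->
   (forall n : nat, b * d - a * e + c * d * n%:R - a * h * n%:R != 0) ->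
   (* the series converges *)
   cvgn (series (term2 a b c d e h r)) ->
   (\int[lebesgue_measure]_(y in `[0%R, 1%R]%classic)
       \int[lebesgue_measure]_(x in `[0%R, 1%R]%classic)
          (integrand2 a b c d e h r x y)%:E)%E
   = (limn (series (term2 a b c d e h r)))%:E).
Proof.
have mlnV : measurable_fun [set: R] (fun z : R => - (ln z)^-1).
  apply: (measurableT_comp (@oppr_measurable R setT)).
  by apply: (measurableT_comp (@measurable_inv R)); exact: measurable_ln.
split; last first.
  move=> b0 c0 e0 h0 ab0 de0 disc rt.
  have [iF FE] := integral_square_term2 R a b c d e h r b0 c0 e0 h0 ab0 de0 disc rt.
  rewrite -FE; apply: integral_unit_square iF.
    by move=> x y _ _; rewrite /integrand2 /powR_kernel /= invfM !mulrA mulrAC.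
  apply: measurable_powR_kernel; apply: measurable_funM.
    exact: measurable_funB.
  by apply: (measurableT_comp (@measurable_inv R)); exact: measurable_ln.
move=> b0 c0 g0 h0 da0 disc rt.
(* [0 < d / a] gives [a] and [d] the same sign, and excludes [a = 0], where the quotient is [0] by
   convention. *)
have [a0|a0|aE] := ltgtP 0 a; last by move: da0; rewrite -aE invr0 mulr0 ltxx.
- have d0 : 0 < d by move: da0; rewrite pmulr_lgt0// invr_gt0.
  have [iF FE] := integral_square_term1_pos R a b c d g h r a0 d0 b0 c0 g0 h0 disc rt.
  (* On the square [integrand1] is [- F]; the minus sign in front of the double integral cancels
     this one. *)
  pose F := powR_kernel R a b c d g h r (fun z => - (ln z)^-1).
  have mF : measurable_fun setT F by exact: measurable_powR_kernel.
  rewrite (integral_unit_square R _ (fun z => - F z)).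
  + under eq_integral do rewrite EFinN.
    rewrite integralN ?oppeK//; apply: integrable_add_def iF.
    by apply: measurableX; exact: measurable_itv.
  + move=> x y _ _; rewrite /integrand1 /F /powR_kernel /= invfM.
    ring.
  + exact: (measurableT_comp (@oppr_measurable R setT) mF).
  + exact: integrableN iF.
(* Passing to [- a] and [- d] reverses the sign of the logarithm in the integrand and of every term,
   which reduces to the positive case. The kernel for [- a] and [- d] is then [integrand1] itself,
   and the outer minus sign matches that of the series. *)
- have d0 : d < 0.
    by move: da0; rewrite nmulr_lgt0// invr_lt0.
  have t1N : term1 (- a) b c (- d) g h r = - term1 a b c d g h r.
    apply/funext => n; rewrite /term1 /= fctE invrN mulrNN.
    rewrite -mulrN -[X in _ = r ^+ n * X]mulrN -invrN; congr (_ * (_ / _)); ring.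
  have sN : series (term1 (- a) b c (- d) g h r) = - series (term1 a b c d g h r).
    by rewrite t1N; apply/funext => n; rewrite /series /= sumrN.
  have [| | | |iF FE] := integral_square_term1_pos R (- a) b c (- d) g h r _ _ b0 c0 g0 h0.
  + by rewrite oppr_gt0.
  + by rewrite oppr_gt0.
  + by move=> n; have := disc n; rewrite -oppr_eq0; congr (_ != 0); ring.
  + by rewrite sN; exact: is_cvgN.
  rewrite (integral_unit_square R _
    (powR_kernel R (- a) b c (- d) g h r (fun z => - (ln z)^-1))) //.
  + by rewrite FE sN limN// EFinN oppeK.
  + move=> x y; rewrite /= !in_itv/= => /andP[x0 _] /andP[y0 _].
    rewrite /integrand1 /powR_kernel /= !ln_monomial// !mulNr -opprD invrN opprK.
    by rewrite invfM; ring.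
  + exact: measurable_powR_kernel.
Qed.
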